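(* Let $d\in\mathbb{N}$. A sequence $(x_n)_{n=1}^\infty\subseteq[0,1]^d$ is an o-sequence if and only if for each $h\in\mathbb{N}$ the sequence $(x_n,x_{n+h})_{n=1}^\infty\subseteq[0,1]^{2d}$ is uniformly distributed.
   Context: Notation: $\mathbb{N}=\{1,2,3,\dots\}$; $m^d$ is Lebesgue measure on $[0,1]^d$. A sequence in $[0,1]^d$ is uniformly distributed if for every axis-parallel box $B\subseteq[0,1]^d$ the proportion of the first $N$ terms lying in $B$ tends to $m^d(B)$ as $N\to\infty$. Permissible triple: for a bounded complex sequence $(z_n)_{n=1}^\infty$ and an increasing sequence $(N_q)_{q=1}^\infty\subseteq\mathbb{N}$, the triple $((z_n),(z_n),(N_q))$ is permissible if $\lim_{q\to\infty}\frac1{N_q}\sum_{n=1}^{N_q}z_{n+h}\overline{z_n}$ exists for all $h\in\mathbb{N}$. A bounded complex sequence $(z_n)_{n=1}^\infty$ is nearly orthogonal if for every permissible triple $((z_n),(z_n),(N_q))$ one has $\lim_{q\to\infty}\left|\frac1{N_q}\sum_{n=1}^{N_q}z_{n+h}\overline{z_n}\right|=0$ for all $h\in\mathbb{N}$. A sequence $(x_n)_{n=1}^\infty\subseteq[0,1]^d$ is an o-sequence if for every (complex-valued) $f\in C([0,1]^d)$ with $\int_{[0,1]^d}f\,dm^d=0$ the sequence $(f(x_n))_{n=1}^\infty$ is nearly orthogonal. *)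

(* Defs.v *)
From HB Require Import structures.
From mathcomp Require Import all_boot all_order all_algebra.
From mathcomp Require Import complex.
From mathcomp Require Import all_classical all_reals all_analysis.

Set Implicit Arguments.
Unset Strict Implicit.
Unset Printing Implicit Defensive.

Import Order.TTheory GRing.Theory Num.Theory.
Import numFieldNormedType.Exports.

Local Open Scope classical_set_scope.
Local Open Scope ring_scope.

(* R^n is 'rV[R]_n, with the library's (sup norm, i.e. product) topology and
   the sigma-algebra generated by the n coordinate maps. *)
Definition rV_display : measure_display. Proof. by constructor. Qed.

Section rV_measurable.
Context (R : realType) (n : nat).

Let coord : 'I_n -> 'rV[R]_n -> measurableTypeR R := fun i x => x ord0 i.

Let rV_set0 : g_sigma_preimage coord set0.
Proof. exact: sigma_algebra0. Qed.

Let rV_setC A : g_sigma_preimage coord A -> g_sigma_preimage coord (~` A).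
Proof. exact: sigma_algebraC. Qed.

Let rV_bigcup (F : _^nat) : (forall i, g_sigma_preimage coord (F i)) ->
  g_sigma_preimage coord (\bigcup_i (F i)).
Proof. exact: sigma_algebra_bigcup. Qed.

HB.instance Definition _ := @isMeasurable.Build rV_display
  'rV[R]_n (g_sigma_preimage coord) rV_set0 rV_setC rV_bigcup.

Lemma measurable_coord (i : 'I_n) :
  measurable_fun [set: 'rV[R]_n]
    (fun x : 'rV[R]_n => x ord0 i : measurableTypeR R).
Proof.
move=> _ Y mY; rewrite setTI; apply: sub_sigma_algebra => /=.
rewrite -bigcup_seq/=; exists i => /=; first by rewrite mem_index_enum.
by exists Y => //; rewrite setTI.
Qed.

Lemma measurable_rV_setX (A : 'I_n -> set (measurableTypeR R)) :
  (forall i, measurable (A i)) ->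
  measurable [set x : 'rV[R]_n | forall i, A i (x ord0 i)].
Proof.
move=> mA.
have -> : [set x : 'rV[R]_n | forall i, A i (x ord0 i)] =
    \bigcap_(i in [set: 'I_n])
      (fun x : 'rV[R]_n => x ord0 i : measurableTypeR R) @^-1` A i.
  by apply/seteqP; split => x /= Ax i; [move=> _; exact: Ax|exact: (Ax i I)].
apply: fin_bigcap_measurable => // i _.
by rewrite -[X in measurable X]setTI; exact: measurable_coord.
Qed.

Lemma measurable_fun_rV d (T : measurableType d) (f : T -> 'rV[R]_n) :
  (forall i, measurable_fun [set: T]
    (fun t => f t ord0 i : measurableTypeR R)) ->
  measurable_fun [set: T] f.
Proof.
move=> mf _ A mA; rewrite setTI.
suff : (g_sigma_preimage coord `<=` [set B | measurable (f @^-1` B)]).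
  exact.
apply: smallest_sub.
  split => /=.
  - by rewrite preimage_set0.
  - by move=> B mB; rewrite setTD preimage_setC; exact: measurableC.
  - by move=> F mF; rewrite preimage_bigcup; exact: bigcup_measurable.
rewrite -bigcup_seq/=; apply: bigcup_sub => i _ B [C mC <-] /=.
rewrite setTI; have := mf i measurableT C mC; by rewrite setTI.
Qed.

End rV_measurable.

Section lebesgue_rV.
Context (R : realType).

Definition rV_cons (n : nat) (p : measurableTypeR R * 'rV[R]_n) :
    'rV[R]_n.+1 :=
  row_mx (const_mx p.1 : 'rV[R]_1) p.2.

Lemma rV_cons0 n p : @rV_cons n p ord0 ord0 = p.1.
Proof.
by rewrite /rV_cons mxE; case: splitP => // j _; rewrite mxE.
Qed.

Lemma rV_consS n p (i : 'I_n) : @rV_cons n p ord0 (lift ord0 i) = p.2 ord0 i.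
Proof.
rewrite /rV_cons mxE; case: splitP => [[[]//]|j /= ij].
by congr (p.2 _ _); apply/val_inj; move: ij; rewrite /= /bump !add1n => -[].
Qed.

Lemma measurable_rV_cons n :
  measurable_fun [set: measurableTypeR R * 'rV[R]_n] (@rV_cons n).
Proof.
apply: measurable_fun_rV => i; case: (unliftP ord0 i) => [j|] ->.
- under eq_fun do rewrite rV_consS.
  exact: (measurableT_comp (@measurable_coord R n j) measurable_snd).
- under eq_fun do rewrite rV_cons0.
  exact: measurable_fst.
Qed.

Definition rV_uncons (n : nat) (x : 'rV[R]_n.+1) :
    measurableTypeR R * 'rV[R]_n :=
  (x ord0 ord0, \row_j x ord0 (lift ord0 j)).

Lemma rV_consK n : cancel (@rV_cons n) (@rV_uncons n).
Proof.
move=> -[a v]; rewrite /rV_uncons rV_cons0; congr (_, _).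
by apply/rowP => j; rewrite mxE rV_consS.
Qed.

Lemma measurable_rV_uncons n : measurable_fun [set: 'rV[R]_n.+1] (@rV_uncons n).
Proof.
apply: measurable_fun_pair; first exact: measurable_coord.
apply: measurable_fun_rV => i; under eq_fun do rewrite mxE.
exact: measurable_coord.
Qed.

Section lebesgue_rV_step.
Context (n : nat) (m : {sigma_finite_measure set 'rV[R]_n -> \bar R}).

Definition rV_cons_measure : set 'rV[R]_n.+1 -> \bar R :=
  pushforward (@lebesgue_measure R \x m)%E (@rV_cons n).

HB.instance Definition _ := Measure.copy rV_cons_measure
  (measure_function_pushforward__canonical__measure_function_Measure
    (@lebesgue_measure R \x m)%E (@measurable_rV_cons n)).

Let rV_cons_measure_sigma_finite : sigma_finite setT rV_cons_measure.
Proof.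
have /sigma_finiteP[F [TF ndF Foo]] := sigma_finiteT (@lebesgue_measure R).
have /sigma_finiteP[G [TG ndG Goo]] := sigma_finiteT m.
exists (fun k => @rV_uncons n @^-1` (F k `*` G k)).
  rewrite -preimage_bigcup; apply/esym/seteqP; split => // x _.
  have [i _ Fx] : (\bigcup_i F i) (rV_uncons x).1 by rewrite -TF.
  have [j _ Gx] : (\bigcup_i G i) (rV_uncons x).2 by rewrite -TG.
  exists (maxn i j) => //; split.
  - by move: Fx; exact/subsetPset/ndF/leq_maxl.
  - by move: Gx; exact/subsetPset/ndG/leq_maxr.
move=> k; have [mF Fk] := Foo k; have [mG Gk] := Goo k; split.
  rewrite -[X in measurable X]setTI; apply: measurable_rV_uncons => //.
  exact: measurableX.
rewrite /rV_cons_measure /pushforward -comp_preimage.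
rewrite (_ : _ \o _ = id) ?preimage_id; last first.
  by apply/funext => p /=; rewrite rV_consK.
by rewrite product_measure1E// lte_mul_pinfty// ge0_fin_numE.
Qed.

HB.instance Definition _ := Measure_isSigmaFinite.Build _ _ _ rV_cons_measure
  rV_cons_measure_sigma_finite.

End lebesgue_rV_step.

(* n-dimensional Lebesgue measure, as an iterated product *)
Fixpoint lebesgue_rV (n : nat) :
    {sigma_finite_measure set 'rV[R]_n -> \bar R} :=
  match n with
  | 0%N => \d_(0 : 'rV[R]_0)
  | k.+1 => rV_cons_measure (lebesgue_rV k)
  end.

Lemma lebesgue_rV_setX n (A : 'I_n -> set (measurableTypeR R)) :
  (forall i, measurable (A i)) ->
  lebesgue_rV n [set x | forall i, A i (x ord0 i)] =
  (\prod_(i < n) lebesgue_measure (A i))%E.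
Proof.
elim: n A => [|n IHn] A mA.
  rewrite big_ord0 /= diracE mem_set // => -[].
  by [].
rewrite big_ord_recl -IHn //= /rV_cons_measure /pushforward.
rewrite -product_measure1E //; last first.
  by apply: (measurable_rV_setX (A := fun i => A (lift ord0 i))) => i.
congr (_ _); apply/seteqP; split => -[a v] /=.
- move=> Av; split => [|i]; first by have := Av ord0; rewrite rV_cons0.
  by have := Av (lift ord0 i); rewrite rV_consS.
- move=> [/= Aa Av] i; case: (unliftP ord0 i) => [j|] ->.
    by rewrite rV_consS; exact: Av.
  by rewrite rV_cons0.
Qed.

End lebesgue_rV.

Definition unit_cube (R : realType) (d : nat) : set 'rV[R]_d :=
  [set x | forall i, x ord0 i \in `[0, 1]].
Arguments unit_cube : clear implicits.

(* Each side may be open, closed or half-open, and degenerate or empty. *)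
Definition box (R : realType) (d : nat) (I : 'I_d -> interval R) :
    set 'rV[R]_d :=
  [set x | forall i, x ord0 i \in I i].

(* R[i] carries the topology of its modulus, as a normed space over itself. *)
HB.instance Definition _ (R : rcfType) := NormedModule.copy R[i] R[i]^o.

(* Sequences are indexed from 0: u n is the (n+1)-st term, and the first N
   terms are the u n with n < N. *)
Definition uniformly_distributed (R : realType) (d : nat)
    (u : nat -> 'rV[R]_d) : Prop :=
  forall I : 'I_d -> interval R, box I `<=` unit_cube R d ->
    #|[pred n : 'I_N | u n \in box I]|%:R / N%:R
      @[N --> \oo] --> fine (lebesgue_rV R d (box I)).

Section nearly_orthogonal.
Context (R : realType).
Implicit Type z : nat -> R[i].

Definition bounded_seq z : Prop := exists M : R, forall n, `|z n| <= M%:C%C.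

Definition correlation z (N h : nat) : R[i] :=
  (\sum_(n < N) z (n + h)%N * (z n)^* ) / N%:R.

Definition permissible z (Nq : nat -> nat) : Prop :=
  [/\ bounded_seq z,
      forall q, (0 < Nq q)%N,
      {homo Nq : p q / (p < q)%N} &
      forall h, (0 < h)%N -> cvg (correlation z (Nq q) h @[q --> \oo])].

Definition nearly_orthogonal z : Prop :=
  bounded_seq z /\
  forall Nq, permissible z Nq -> forall h, (0 < h)%N ->
    `|correlation z (Nq q) h| @[q --> \oo] --> (0 : R[i]).

End nearly_orthogonal.

Definition cube_integral (R : realType) (d : nat) (f : 'rV[R]_d -> R[i]) :
    R[i] :=
  ((\int[lebesgue_rV R d]_(x in unit_cube R d) complex.Re (f x)) +i*
   (\int[lebesgue_rV R d]_(x in unit_cube R d) complex.Im (f x)))%C.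

Definition o_sequence (R : realType) (d : nat) (x : nat -> 'rV[R]_d) : Prop :=
  forall f : 'rV[R]_d -> R[i],
    {within unit_cube R d, continuous f} -> cube_integral f = 0 ->
    nearly_orthogonal (f \o x).

(* Main.v *)
Require Import Defs.
From mathcomp Require Import all_boot all_order all_algebra.
From mathcomp Require Import all_classical all_reals all_analysis.
From mathcomp Require Import measurable_realfun complex ring lra.

(** Both directions go through a property of a sequence [x] in the cube, called
    [decorrelated] below: for a lag [h] and real functions [u], [v], the averages
    of [u (x (n + h)) * v (x n)] tend to the product of the means of [u] and [v].

    Uniform distribution of the pairs [(x n, x (n + h))] says exactly that
    indicators of boxes are decorrelated.  By bilinearity so are step functions
    on a grid, and a continuous function on the compact cube is a uniform limit
    of step functions ([cvg_grid_approx]); hence continuous functions are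
    decorrelated ([decorrelated_continuous]).  Conversely, a box indicator lies
    between two continuous functions with almost equal means, products of
    trapezoids ([box_sandwich]), so decorrelation of continuous functions gives
    back uniform distribution ([decorrelated_uniformly_distributed]).

    If continuous functions are decorrelated, then [x] is an o-sequence
    ([decorrelated_o_sequence]): the real and imaginary parts of a correlation
    of [f] along [x] are combinations of real averages, each of which tends to
    a product of two means of the real or imaginary part of [f], that is to [0].

    The remaining implication ([o_sequence_decorrelated]) has three ingredients.
    - Near orthogonality speaks only of subsequences along which the
      correlations at all lags converge.  By compactness every infinite set of
      indices contains such a subsequence ([diagonal_extraction]), so the
      correlations of a nearly orthogonal sequence tend to [0] along all
      indices ([nearly_orthogonal_correlation]).
    - This controls a function against itself.  Polarization with [u + i v] and
      [u + v] yields pairs of functions of mean zero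
      ([o_sequence_decorrelated0]); complex values are essential, since the
      antisymmetric part of the bilinear form is the imaginary part of a
      correlation.
    - To reach functions of arbitrary mean one needs that the averages of
      [u (x n)] tend to the mean of [u].  For mean zero this is van der Corput's
      difference theorem ([van_der_corput]): a bounded sequence whose
      correlations vanish in the limit has averages tending to [0]. *)

Set Implicit Arguments.
Unset Strict Implicit.
Unset Printing Implicit Defensive.

Import Order.TTheory GRing.Theory Num.Theory.
Import numFieldNormedType.Exports.

Local Open Scope classical_set_scope.
Local Open Scope ring_scope.

(** * Averages of real sequences *)

Lemma prod_dist (R : realDomainType) (a b c e r M : R) :
  `|a - c| <= r -> `|b - e| <= r ->
  `|b| <= M -> `|c| <= M -> `|a * b - c * e| <= 2 * M * r.
Proof.
move=> ac be bM cM.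
have -> : a * b - c * e = (a - c) * b + c * (b - e) by ring.
rewrite (le_trans (ler_normD _ _))// !normrM.
have -> : 2 * M * r = r * M + M * r by ring.
by rewrite lerD// ler_pM.
Qed.

Section cesaro_means.
Context {R : realType}.
Implicit Types (a F G z : nat -> R).

Definition cesaro_mean F (N : nat) : R := (\sum_(n < N) F n) / N%:R.

Lemma cesaro_meanD F G N :
  cesaro_mean (fun n => F n + G n) N = cesaro_mean F N + cesaro_mean G N.
Proof. by rewrite /cesaro_mean big_split mulrDl. Qed.

Lemma cesaro_meanZ (c : R) F N :
  cesaro_mean (fun n => c * F n) N = c * cesaro_mean F N.
Proof. by rewrite /cesaro_mean -mulr_sumr mulrA. Qed.

Lemma cesaro_meanN F N : cesaro_mean (fun n => - F n) N = - cesaro_mean F N.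
Proof. by rewrite /cesaro_mean sumrN mulNr. Qed.

Lemma cesaro_meanB F G N :
  cesaro_mean (fun n => F n - G n) N = cesaro_mean F N - cesaro_mean G N.
Proof. by rewrite cesaro_meanD cesaro_meanN. Qed.

Lemma cesaro_mean_sum (I : Type) (r : seq I) (P : pred I) (F : I -> nat -> R) N :
  cesaro_mean (fun n => \sum_(i <- r | P i) F i n) N =
  \sum_(i <- r | P i) cesaro_mean (F i) N.
Proof. by rewrite /cesaro_mean exchange_big mulr_suml. Qed.

Lemma le_cesaro_mean F G N :
  (forall n, F n <= G n) -> cesaro_mean F N <= cesaro_mean G N.
Proof.
by move=> FG; rewrite ler_wpM2r ?invr_ge0 ?ler0n//; apply: ler_sum => i _.
Qed.

Lemma cvg_cesaro_mean_cst (c : R) : cesaro_mean (fun=> c) N @[N --> \oo] --> c.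
Proof.
apply: cvg_near_cst; near=> N.
have N0 : N%:R != 0 :> R by rewrite pnatr_eq0 -lt0n; near: N; exists 1%N.
by rewrite /cesaro_mean sumr_const card_ord -[c *+ N]mulr_natr mulfK.
Unshelve. all: by end_near. Qed.

(** The sum of the increments telescopes to a bounded quantity, which is then
    divided by [N]. *)
Lemma cvg_cesaro_mean_increment G (M : R) : (forall n, `|G n| <= M) ->
  cesaro_mean (fun n => G n.+1 - G n) N @[N --> \oo] --> (0 : R).
Proof.
move=> GM.
have -> : cesaro_mean (fun n => G n.+1 - G n) = (fun N => (G N - G 0%N) / N%:R).
  apply/funext => N; rewrite /cesaro_mean.
  by rewrite -(big_mkord xpredT (fun n => G n.+1 - G n)) telescope_sumr.
apply/cvgr0Pnorm_le => e e0; near=> N.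
have N0 : 0 < N%:R :> R by rewrite ltr0n; near: N; exists 1%N.
rewrite normrM normfV (@gtr0_norm _ N%:R)// ler_pdivrMr//.
apply: (@le_trans _ _ (M + M)).
  by rewrite (le_trans (ler_normB _ _))// lerD.
rewrite mulrC -ler_pdivrMr//; near: N; exact: nbhs_infty_ger.
Unshelve. all: by end_near. Qed.

(** The difference is the increment of the bounded sequence of window sums
    [F n + ... + F (n + k - 1)]. *)
Lemma cvg_cesaro_mean_shiftB F (M : R) (k : nat) : (forall n, `|F n| <= M) ->
  cesaro_mean (fun n => F (n + k)%N - F n) N @[N --> \oo] --> (0 : R).
Proof.
move=> FM; pose G n := \sum_(j < k) F (n + j)%N.
have -> : (fun n => F (n + k)%N - F n) = (fun n => G n.+1 - G n).
  apply/funext => n; rewrite /G -sumrB.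
  rewrite -(big_mkord xpredT (fun j => F (n.+1 + j)%N - F (n + j)%N)).
  under eq_bigr do rewrite addSnnS.
  by rewrite (telescope_sumr (fun j => F (n + j)%N))// addn0.
apply: (@cvg_cesaro_mean_increment _ (k%:R * M)) => n.
rewrite (le_trans (ler_norm_sum _ _ _))//.
rewrite (le_trans (ler_sum _ (fun i _ => FM _)))//.
by rewrite sumr_const card_ord mulr_natl.
Qed.

Lemma cvg_cesaro_mean_shift F (M l : R) (k : nat) : (forall n, `|F n| <= M) ->
  cesaro_mean F N @[N --> \oo] --> l ->
  cesaro_mean (fun n => F (n + k)%N) N @[N --> \oo] --> l.
Proof.
move=> FM Fl.
have -> : cesaro_mean (fun n => F (n + k)%N) =
    (fun N => cesaro_mean (fun n => F (n + k)%N - F n) N + cesaro_mean F N).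
  by apply/funext => N; rewrite cesaro_meanB subrK.
by rewrite -[l]add0r; apply: cvgD => //; exact: cvg_cesaro_mean_shiftB FM.
Qed.

(** A squeeze lemma whose bounds may depend on the error [e]: every
    approximation argument below (step functions, trapezoids, windows of
    varying length) has this shape. *)
Lemma cvg_of_approx a (l : R) :
  (forall e, 0 < e -> exists b c lb lc,
    [/\ b N @[N --> \oo] --> lb, c N @[N --> \oo] --> lc,
        forall N, b N <= a N <= c N & l - e <= lb /\ lc <= l + e]) ->
  a N @[N --> \oo] --> l.
Proof.
move=> H; apply/cvgrPdist_le => e e0.
have e2 : 0 < e / 2 by rewrite divr_gt0.
have [b [c [lb [lc [/cvgrPdist_le blb /cvgrPdist_le clc bac [llb lcl]]]]]] := H _ e2.
near=> N.
have : `|lb - b N| <= e / 2 by near: N; exact: blb.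
have : `|lc - c N| <= e / 2 by near: N; exact: clc.
have /andP[? ?] := bac N.
rewrite !ler_norml; lra.
Unshelve. all: by end_near. Qed.

Lemma cvg_sumr (I : Type) (r : seq I) (P : pred I) (F : I -> nat -> R)
    (l : I -> R) : (forall i, P i -> F i N @[N --> \oo] --> l i) ->
  \sum_(i <- r | P i) F i N @[N --> \oo] --> \sum_(i <- r | P i) l i.
Proof. by move=> Fl; apply: cvg_big => //; exact: add_continuous. Qed.

(** Van der Corput's difference theorem.  Averaging [z] over windows of length
    [H] changes its Cesaro mean by a vanishing amount.  The mean square of the
    window sum [w] is at most [H * M ^+ 2] from the diagonal terms, plus
    off-diagonal terms that are averages of [z (n + h) * z n] and hence tend
    to [0].  So the mean of [w / H] is eventually about [M / sqrt H] at most. *)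
Lemma van_der_corput z (M : R) : (forall n, `|z n| <= M) ->
  (forall h, (0 < h)%N ->
    cesaro_mean (fun n => z (n + h)%N * z n) N @[N --> \oo] --> (0 : R)) ->
  cesaro_mean z N @[N --> \oo] --> (0 : R).
Proof.
move=> zM zz.
have M0 : 0 <= M by apply: le_trans (zM 0%N).
pose C h k N := cesaro_mean (fun n => z (n + h)%N * z (n + k)%N) N.
have C0 h k : h != k -> C h k N @[N --> \oo] --> (0 : R).
  wlog kh : h k / (k < h)%N => [H|_].
    case: (ltngtP h k) => // hk _; last by apply: H => //; rewrite gtn_eqF.
    rewrite (_ : C h k = C k h); first by apply: H => //; rewrite gtn_eqF.
    by apply/funext => N; rewrite /C; under eq_fun do rewrite mulrC.
  have -> : C h k =
      cesaro_mean (fun n => z (n + k + (h - k))%N * z (n + k)%N).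
    apply/funext => N; rewrite /C; congr cesaro_mean; apply/funext => n.
    by rewrite -addnA subnKC// ltnW.
  apply: (@cvg_cesaro_mean_shift (fun n => z (n + (h - k))%N * z n) (M * M)).
    by move=> n; rewrite normrM ler_pM.
  by apply: zz; rewrite subn_gt0.
pose w H n := \sum_(h < H) z (n + h)%N.
pose off H N := \sum_(h < H) \sum_(k < H | k != h) C h k N.
have off0 H : off H N @[N --> \oo] --> (0 : R).
  rewrite (_ : 0 = \sum_(h < H) \sum_(k < H | k != h) (0 : R)); last first.
    by rewrite big1// => i _; rewrite big1.
  apply: cvg_sumr => h _; apply: cvg_sumr => k kh.
  by apply: C0; rewrite eq_sym.
have w2 H N : cesaro_mean (fun n => w H n ^+ 2) N <= 
    cesaro_mean (fun=> H%:R * M ^+ 2) N + off H N.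
  have -> : (fun n => w H n ^+ 2) = (fun n => 
      \sum_(h < H) \sum_(k < H) z (n + h)%N * z (n + k)%N).
    apply/funext => n; rewrite expr2 mulr_suml.
    by apply: eq_bigr => h _; rewrite mulr_sumr.
  rewrite cesaro_mean_sum.
  under eq_bigr => h _.
    rewrite cesaro_mean_sum (bigD1 h)//=; over.
  rewrite big_split/= lerD2r -cesaro_mean_sum; apply: le_cesaro_mean => n.
  rewrite -[X in X%:R](card_ord H) mulr_natl -sumr_const.
  apply: ler_sum => h _; rewrite -expr2 -real_normK ?num_real//.
  by rewrite lerXn2r ?nnegrE.
have wz H : (0 < H)%N ->
    cesaro_mean (fun n => w H n / H%:R - z n) N @[N --> \oo] --> (0 : R).
  move=> H0; have H0' : H%:R != 0 :> R by rewrite pnatr_eq0 -lt0n.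
  have -> : cesaro_mean (fun n => w H n / H%:R - z n) = (fun N =>
      H%:R^-1 * \sum_(h < H) cesaro_mean (fun n => z (n + h)%N - z n) N).
    apply/funext => N; rewrite -cesaro_mean_sum -cesaro_meanZ.
    congr cesaro_mean; apply/funext => n.
    rewrite sumrB mulrBr sumr_const card_ord.
    by rewrite -[z n *+ H]mulr_natl mulKf// mulrC.
  have w0 : \sum_(h < H) cesaro_mean (fun n => z (n + h)%N - z n) N
      @[N --> \oo] --> \sum_(h < H) (0 : R).
    by apply: cvg_sumr => h _; exact: cvg_cesaro_mean_shiftB zM.
  have := cvgM (cvg_cst (H%:R^-1 : R)) w0; rewrite big1// mulr0; exact.
apply: cvg_of_approx => e e0.
(* [H] makes the diagonal contribution [M ^+ 2 / (2 * e * H)] at most [e / 2]. *)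
pose H := (Num.truncn (M ^+ 2 / e ^+ 2)).+1.
have MH : M ^+ 2 / e ^+ 2 <= H%:R.
  by rewrite ltW// truncnS_gt.
have H0 : 0 < H%:R :> R by rewrite ltr0n.
pose d N := cesaro_mean (fun n => w H n / H%:R - z n) N.
pose t N := cesaro_mean (fun=> e / 2) N +
  (2 * e * H%:R ^+ 2)^-1 * (cesaro_mean (fun=> H%:R * M ^+ 2) N + off H N).
have t_cvg : t N @[N --> \oo] -->
    e / 2 + (2 * e * H%:R ^+ 2)^-1 * (H%:R * M ^+ 2 + 0).
  by apply: cvgD; [exact: cvg_cesaro_mean_cst|apply: cvgM; [exact: cvg_cst|apply: cvgD];
    [exact: cvg_cesaro_mean_cst|exact: off0]].
have t_le : e / 2 + (2 * e * H%:R ^+ 2)^-1 * (H%:R * M ^+ 2 + 0) <= e.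
  rewrite addr0; move: MH; rewrite ler_pdivrMr ?exprn_gt0// => MH.
  suff : (2 * e * H%:R ^+ 2)^-1 * (H%:R * M ^+ 2) <= e / 2 by lra.
  rewrite mulrC ler_pdivrMr; last by rewrite !mulr_gt0// exprn_gt0.
  have -> : e / 2 * (2 * e * H%:R ^+ 2) = H%:R * (H%:R * e ^+ 2) by field.
  by rewrite ler_wpM2l// ltW.
(* The inequality [|X| <= e / 2 + X ^+ 2 / (2 * e)], applied to [X = w / H],
   replaces the square root of Cauchy-Schwarz; the sign [s] treats both bounds
   at once. *)
have wt N : `|cesaro_mean (fun n => w H n / H%:R) N| <= t N.
  have le_t (s : R) : s ^+ 2 = 1 ->
      cesaro_mean (fun n => s * (w H n / H%:R)) N <= t N.
    move=> s1; rewrite /t.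
    apply: (@le_trans _ _ (cesaro_mean (fun=> e / 2) N + 
        cesaro_mean (fun n => (2 * e * H%:R ^+ 2)^-1 * (w H n) ^+ 2) N)).
      rewrite -cesaro_meanD; apply: le_cesaro_mean => n.
      rewrite -subr_ge0.
      have -> : e / 2 + (2 * e * H%:R ^+ 2)^-1 * w H n ^+ 2 - s * (w H n / H%:R)
         = (2 * e)^-1 * ((w H n / H%:R - s * e) ^+ 2 + (1 - s ^+ 2) * e ^+ 2).
        by field; rewrite !gt_eqF.
      rewrite s1 subrr mul0r addr0 mulr_ge0 ?sqr_ge0//.
      by rewrite invr_ge0 ltW// mulr_gt0.
    rewrite lerD2l (cesaro_meanZ _ (fun n => w H n ^+ 2)) ler_wpM2l//.
    by rewrite invr_ge0 ltW// !mulr_gt0// exprn_gt0.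
  rewrite ler_norml; apply/andP; split.
    rewrite lerNl -cesaro_meanN; under eq_fun do rewrite -mulN1r.
    by apply: le_t; rewrite sqrrN expr1n.
  have := le_t 1 (expr1n _ _); by under eq_fun do rewrite mul1r.
exists (fun N => - d N - t N), (fun N => - d N + t N).
exists (- 0 - (e / 2 + (2 * e * H%:R ^+ 2)^-1 * (H%:R * M ^+ 2 + 0))).
exists (- 0 + (e / 2 + (2 * e * H%:R ^+ 2)^-1 * (H%:R * M ^+ 2 + 0))).
have dcvg : - d N @[N --> \oo] --> - (0 : R) by apply: cvgN; exact: wz.
split.
- exact: cvgB.
- exact: cvgD.
- move=> N; have := wt N; rewrite /d cesaro_meanB ler_norml; lra.
- by split; rewrite oppr0; lra.
Qed.

End cesaro_means.

(** * Continuous functions on the cube and their means *)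

Section cube.
Context {R : realType} {d : nat}.
Notation cube := (unit_cube R d).
Notation mu := (lebesgue_rV R d).
Implicit Types (u v : 'rV[R]_d -> R) (I : 'I_d -> interval R).

Lemma measurable_box I : measurable (box I).
Proof. exact: (measurable_rV_setX (A := fun i => [set` I i])). Qed.

Lemma lebesgue_box I :
  mu (box I) = (\prod_(i < d) lebesgue_measure [set` I i])%E.
Proof. exact: lebesgue_rV_setX. Qed.

Lemma measurable_cube : measurable cube.
Proof. exact: (measurable_box (fun=> `[0, 1])). Qed.
Hint Resolve measurable_cube : core.

Lemma lebesgue_cube : mu cube = 1%E.
Proof.
rewrite (lebesgue_box (fun=> `[0, 1])) big1// => i _.
by rewrite lebesgue_measure_itv/= lte_fin ltr01 oppr0 adde0.
Qed.

Lemma compact_cube : compact cube.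
Proof.
have := @rV_compact R d (fun=> `[0, 1]%classic) (fun=> @segment_compact R 0 1).
by [].
Qed.

Section grid.
Variable k : nat.

Definition grid_point (j : 'I_d -> nat) : 'rV[R]_d :=
  \row_i ((j i)%:R / k.+1%:R).

(** The meet with [[0, 1]] keeps the cells inside the cube; the index [k.+1]
    then gives the degenerate cell [{1}], so that the cells cover the cube. *)
Definition grid_cell (j : 'I_d -> nat) (i : 'I_d) : interval R :=
  (`[(j i)%:R / k.+1%:R, (j i).+1%:R / k.+1%:R[ `&` `[0, 1])%O.

Lemma grid_cell_cube j : box (grid_cell j) `<=` cube.
Proof. by move=> x jx i; have := jx i; rewrite in_itvI => /andP[]. Qed.

Lemma in_grid_cell j x : cube x ->
  box (grid_cell j) x <-> forall i, j i = Num.truncn (k.+1%:R * x ord0 i).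
Proof.
move=> cx; have k0 : 0 < k.+1%:R :> R by rewrite ltr0n.
split=> [jx i|jx i]; last first.
  rewrite in_itvI (cx i) andbT in_itv/= ler_pdivrMr// ltr_pdivlMr//.
  rewrite jx [x _ _ * _]mulrC truncn_itv//.
  by rewrite mulr_ge0//; have := cx i; rewrite in_itv/= => /andP[].
have := jx i; rewrite in_itvI => /andP[] + _; rewrite in_itv/=.
rewrite ler_pdivrMr// ltr_pdivlMr// mulrC => jk.
by apply/esym/truncn_def.
Qed.

(** The step function which on each cell takes the value of [u] at the lowest
    corner. *)
Definition grid_approx u (x : 'rV[R]_d) : R :=
  \sum_(j : {ffun 'I_d -> 'I_k.+2})
    u (grid_point (fun i => j i)) * \1_(box (grid_cell (fun i => j i))) x.

(** On the cube the step function is [u] precomposed with rounding down to the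
    grid, so that it inherits bounds from [u] and is controlled by the modulus
    of continuity of [u]. *)
Lemma grid_approxE u x : cube x -> exists y,
  [/\ cube y, forall i, `|x ord0 i - y ord0 i| <= k.+1%:R^-1 &
      grid_approx u x = u y].
Proof.
move=> cx; have k0 : 0 < k.+1%:R :> R by rewrite ltr0n.
have xi i : 0 <= x ord0 i <= 1 by have := cx i; rewrite in_itv.
pose t i := Num.truncn (k.+1%:R * x ord0 i).
have t_itv i : (t i)%:R <= k.+1%:R * x ord0 i < (t i).+1%:R.
  by apply: truncn_itv; rewrite mulr_ge0//; have /andP[] := xi i.
have tk i : (t i < k.+2)%N.
  rewrite ltnS -(ler_nat R); have /andP[+ _] := t_itv i => /le_trans; apply.
  by rewrite ler_piMr//; have /andP[] := xi i.
exists (grid_point t); split => [i|i|].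
- rewrite mxE in_itv/= divr_ge0//= ler_pdivrMr// mul1r ler_nat -ltnS.
  exact: tk.
- rewrite mxE; have /andP[t1 t2] := t_itv i.
  have -> : x ord0 i - (t i)%:R / k.+1%:R =
      (k.+1%:R * x ord0 i - (t i)%:R) / k.+1%:R by field.
  rewrite normrM normfV (gtr0_norm k0) ger0_norm ?subr_ge0//.
  rewrite -[leRHS]mul1r ler_wpM2r ?invr_ge0 ?ltW//.
  by move: t2; rewrite -natr1; lra.
- pose j0 : {ffun 'I_d -> 'I_k.+2} := [ffun i => Ordinal (tk i)].
  have j0t : (fun i => j0 i : nat) = t by apply/funext => i; rewrite ffunE.
  rewrite /grid_approx (bigD1 j0)//= j0t big1 ?addr0 => [|j jj0].
    by rewrite indicE mem_set ?mulr1//; apply/in_grid_cell.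
  rewrite indicE memNset ?mulr0// => /(in_grid_cell _ cx) jx.
  move/eqP : jj0; apply; apply/ffunP => i; apply/val_inj.
  by rewrite ffunE; exact: jx.
Qed.

End grid.

Lemma within_cube_ball u x e : {within cube, continuous u} -> cube x -> 0 < e ->
  exists2 r, 0 < r & forall y, cube y -> (forall i, `|x ord0 i - y ord0 i| < r) ->
    `|u x - u y| <= e.
Proof.
move=> /subspace_continuousP uC cx e0.
have /cvgrPdist_le /(_ _ e0) := uC _ cx.
rewrite near_withinE => /nbhs_ballP[r /= r0 xr]; exists r => // y cy xy.
by apply: xr => //; split=> // i j; rewrite (ord1 i); exact: xy.
Qed.

(** Uniform approximation, by compactness: near each point of the cube the
    values of [u] are close to one another, and for large [k] rounding down
    moves points by little. *)
Lemma cvg_grid_approx u e : {within cube, continuous u} -> 0 < e ->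
  \forall k \near \oo, forall x, cube x -> `|u x - grid_approx k u x| <= e.
Proof.
move=> uC e0; have e2 : 0 < e / 2 by rewrite divr_gt0.
have /compact_near_coveringP cov := compact_cube.
have {}cov := cov nat \oo (fun k x => cube x -> `|u x - grid_approx k u x| <= e).
suff : forall x, cube x -> \forall y \near x & k \near \oo,
    cube y -> `|u y - grid_approx k u y| <= e.
  by move=> /cov H; apply: filterS H => k H x cx; exact: H.
move=> x cx.
have [r r0 xr] := within_cube_ball uC cx e2.
have r2 : 0 < r / 2 by rewrite divr_gt0.
near=> y k => /= cy.
have [z [cz yz ->]] := grid_approxE k u cy.
have xy i : `|x ord0 i - y ord0 i| < r / 2.
  have : ball x (r / 2) y by near: y; exact: nbhsx_ballx.
  by move=> [_ /(_ ord0 i)].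
have kr : k.+1%:R^-1 < r / 2.
  by near: k; exact: near_infty_natSinv_lt (PosNum r2).
have -> : u y - u z = (u x - u z) - (u x - u y) by ring.
rewrite (le_trans (ler_normB _ _))// [leRHS]splitr lerD//; apply: xr => // i.
  have -> : x ord0 i - z ord0 i = (x ord0 i - y ord0 i) + (y ord0 i - z ord0 i).
    by ring.
  rewrite (le_lt_trans (ler_normD _ _))// [ltRHS]splitr ltrD//.
  exact: le_lt_trans kr.
by rewrite (lt_trans (xy i))// ltr_pdivrMr// ltr_pMr// ltr1n.
Unshelve. all: by end_near. Qed.

Lemma measurable_grid_approx k u : measurable_fun cube (grid_approx k u).
Proof.
apply: measurable_sum => j; apply: measurable_funM => //.
by apply: measurable_indic; exact: measurable_box.
Qed.

Lemma continuous_cube_bounded u : {within cube, continuous u} ->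
  exists M, forall x, cube x -> `|u x| <= M.
Proof.
move=> /(cvg_grid_approx)/(_ ltr01) [k _ /(_ k (leqnn k)) uk].
exists (1 + \sum_(j : {ffun 'I_d -> 'I_k.+2}) `|u (grid_point k (fun i => j i))|).
move=> x cx; rewrite -[u x](subrK (grid_approx k u x)).
rewrite (le_trans (ler_normD _ _))// lerD ?uk//.
rewrite (le_trans (ler_norm_sum _ _ _))//; apply: ler_sum => j _.
by rewrite normrM indicE normr_nat ler_piMr// lern1 leq_b1.
Qed.

(** Continuity is assumed relatively to the cube; measurability comes from
    being a limit of step functions on boxes. *)
Lemma continuous_cube_measurable u : {within cube, continuous u} ->
  measurable_fun cube u.
Proof.
move=> uC; apply: (measurable_fun_cvg (h := fun k => grid_approx k u)) => [k|x cx].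
  exact: measurable_grid_approx.
apply/cvgrPdist_le => e e0.
by apply: filterS (cvg_grid_approx uC e0) => k; apply.
Qed.

Lemma bounded_cube_integrable u M : measurable_fun cube u ->
  (forall x, cube x -> `|u x| <= M) -> mu.-integrable cube (EFin \o u).
Proof.
move=> mu_ uM; apply: measurable_bounded_integrable => //.
  (* restores the form of the measure that [lebesgue_cube] speaks of *)
  suff : (mu cube < +oo)%E by [].
  by rewrite lebesgue_cube ltry.
exists M; split; first exact: num_real.
by move=> y My x cx; exact: le_trans (uM _ cx) (ltW My).
Qed.

Lemma continuous_cube_integrable u : {within cube, continuous u} ->
  mu.-integrable cube (EFin \o u).
Proof.
move=> uC; have [M uM] := continuous_cube_bounded uC.
exact: bounded_cube_integrable (continuous_cube_measurable uC) uM.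
Qed.

Lemma indic_box_integrable I : mu.-integrable cube (EFin \o \1_(box I)).
Proof.
apply: (@bounded_cube_integrable _ 1).
  by apply: measurable_indic; exact: measurable_box.
by move=> x _; rewrite indicE normr_nat lern1 leq_b1.
Qed.

Definition cube_mean u : R := \int[mu]_(x in cube) u x.

Lemma cube_mean_cst (c : R) : cube_mean (fun=> c) = c.
Proof.
rewrite /cube_mean Rintegral_cst//.
suff : c * fine (mu cube) = c by [].
by rewrite lebesgue_cube mulr1.
Qed.

Lemma cube_mean_indic I : box I `<=` cube ->
  cube_mean \1_(box I) = fine (mu (box I)).
Proof.
move=> Ic; rewrite /cube_mean /Rintegral integral_indic//; last exact: measurable_box.
by rewrite setIidl.
Qed.

Lemma grid_approx_integrable k u : mu.-integrable cube (EFin \o grid_approx k u).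
Proof.
rewrite (_ : EFin \o _ = fun x => (\sum_(j : {ffun 'I_d -> 'I_k.+2})
    (u (grid_point k (fun i => j i)))%:E *
    (\1_(box (grid_cell k (fun i => j i))) x)%:E)%E).
  by apply: integrable_sum => // j _; apply: integrableZl => //;
    exact: indic_box_integrable.
by apply/funext => x /=; rewrite -sumEFin.
Qed.

Lemma cube_mean_grid_approx k u : cube_mean (grid_approx k u) =
  \sum_(j : {ffun 'I_d -> 'I_k.+2}) u (grid_point k (fun i => j i)) *
    fine (mu (box (grid_cell k (fun i => j i)))).
Proof.
under [RHS]eq_bigr => j _.
  rewrite -cube_mean_indic; last exact: grid_cell_cube.
  rewrite /cube_mean -RintegralZl//; last exact: indic_box_integrable.
  over.
rewrite /cube_mean /Rintegral sum_fine => [|j _].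
  rewrite -integral_sum//; last first.
    move=> j; under eq_fun do rewrite EFinM.
    by apply: integrableZl => //; exact: indic_box_integrable.
  by congr fine; apply: eq_integral => x _; rewrite sumEFin.
apply: integrable_fin_num => //; under eq_fun do rewrite EFinM.
by apply: integrableZl => //; exact: indic_box_integrable.
Qed.

Lemma le_cube_mean u v :
  mu.-integrable cube (EFin \o u) -> mu.-integrable cube (EFin \o v) ->
  (forall x, cube x -> u x <= v x) -> cube_mean u <= cube_mean v.
Proof. by move=> iu iv uv; exact: le_Rintegral. Qed.

Lemma cube_mean_dist u v e :
  mu.-integrable cube (EFin \o u) -> mu.-integrable cube (EFin \o v) ->
  (forall x, cube x -> `|u x - v x| <= e) -> `|cube_mean u - cube_mean v| <= e.
Proof.
move=> iu iv uv; rewrite /cube_mean -RintegralB//.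
have iuv : mu.-integrable cube (EFin \o (fun x => u x - v x)).
  by have := integrableB measurable_cube iu iv.
rewrite (le_trans (le_normr_Rintegral _ _))// -[leRHS]cube_mean_cst.
apply: le_cube_mean => //.
- rewrite (_ : _ \o _ = abse \o (EFin \o (fun x => u x - v x)))//.
  exact: integrable_abse.
- apply: (@bounded_cube_integrable _ `|e|) => //.
Qed.

Lemma cube_mean_bound u (M : R) : mu.-integrable cube (EFin \o u) ->
  (forall x, cube x -> `|u x| <= M) -> `|cube_mean u| <= M.
Proof.
move=> iu uM; rewrite -[cube_mean u]subr0 -[X in _ - X]cube_mean_cst.
apply: cube_mean_dist => //; last by move=> x /uM; rewrite subr0.
by apply: (@bounded_cube_integrable _ 0) => // x _; rewrite normr0.
Qed.

End cube.

(** * From uniformly distributed pairs to decorrelation *)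

Section boxes_of_pairs.
Context {R : realType} {d1 d2 : nat}.
Implicit Types (K : 'I_(d1 + d2) -> interval R).

Lemma box_row_mx K (a : 'rV[R]_d1) (b : 'rV[R]_d2) :
  box K (row_mx a b) <->
  box (K \o @lshift d1 d2) a /\ box (K \o @rshift d1 d2) b.
Proof.
split=> [Kab|[Ka Kb] k].
  by split => i; [have := Kab (lshift d2 i); rewrite row_mxEl|
                  have := Kab (rshift d1 i); rewrite row_mxEr].
case: (split_ordP k) => i ->.
- by rewrite row_mxEl; exact: Ka.
- by rewrite row_mxEr; exact: Kb.
Qed.

Lemma lebesgue_box_row_mx K : lebesgue_rV R (d1 + d2) (box K) =
  (lebesgue_rV R d1 (box (K \o @lshift d1 d2)) *
   lebesgue_rV R d2 (box (K \o @rshift d1 d2)))%E.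
Proof. by rewrite !lebesgue_box big_split_ord. Qed.

Lemma indic_box_row_mx K (a : 'rV[R]_d1) (b : 'rV[R]_d2) :
  \1_(box K) (row_mx a b) =
  \1_(box (K \o @rshift d1 d2)) b * \1_(box (K \o @lshift d1 d2)) a :> R.
Proof.
rewrite !indicE -natrM mulnb; congr (_ _)%:R.
apply/idP/andP => [/set_mem/box_row_mx[? ?]|[/set_mem ? /set_mem ?]].
  by rewrite !mem_set.
exact/mem_set/box_row_mx.
Qed.

Definition pair_itv (I : 'I_d1 -> interval R) (J : 'I_d2 -> interval R)
    (k : 'I_(d1 + d2)) : interval R :=
  match fintype.split k with inl i => I i | inr j => J j end.

Lemma pair_itvl I J : pair_itv I J \o @lshift d1 d2 = I.
Proof. by apply/funext => i; rewrite /pair_itv/= (@unsplitK d1 d2 (inl i)). Qed.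

Lemma pair_itvr I J : pair_itv I J \o @rshift d1 d2 = J.
Proof. by apply/funext => i; rewrite /pair_itv/= (@unsplitK d1 d2 (inr i)). Qed.

Lemma cube_row_mx (a : 'rV[R]_d1) (b : 'rV[R]_d2) :
  unit_cube R (d1 + d2) (row_mx a b) <-> unit_cube R d1 a /\ unit_cube R d2 b.
Proof. exact: (box_row_mx (fun=> `[0, 1])). Qed.

Lemma pair_itv_cube I J :
  box I `<=` unit_cube R d1 -> box J `<=` unit_cube R d2 ->
  box (pair_itv I J) `<=` unit_cube R (d1 + d2).
Proof.
move=> Ic Jc z; rewrite -(hsubmxK z) => /box_row_mx[].
rewrite pair_itvl pair_itvr => zI zJ; apply/cube_row_mx.
by split; [exact: Ic|exact: Jc].
Qed.

End boxes_of_pairs.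

Section decorrelation.
Context {R : realType} {d : nat}.
Variables (x : nat -> 'rV[R]_d).
Hypothesis x_cube : forall n, unit_cube R d (x n).
Notation cube := (unit_cube R d).
Notation mu := (lebesgue_rV R d).

(** The frequency of visits of the pairs to a box is an average of the form
    studied in [decorrelated], for the indicators of the two factors. *)
Lemma pair_box_frequency h (K : 'I_(d + d) -> interval R) :
  (fun N => #|[pred n : 'I_N | row_mx (x n) (x (n + h)%N) \in box K]|%:R / N%:R) =
  cesaro_mean (fun n => \1_(box (K \o @rshift d d)) (x (n + h)%N) *
                        \1_(box (K \o @lshift d d)) (x n) : R).
Proof.
apply/funext => N; rewrite /cesaro_mean; congr (_ / _).
rewrite -sum1_card natr_sum big_mkcond/=; apply: eq_bigr => n _.
by rewrite -indic_box_row_mx indicE inE; case: ifPn.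
Qed.

Lemma fin_num_lebesgue_box (I : 'I_d -> interval R) : box I `<=` cube ->
  mu (box I) \is a fin_num.
Proof.
move=> Ic; rewrite ge0_fin_numE// (@le_lt_trans _ _ (mu cube))//.
  apply: le_measure => //; rewrite inE; first exact: measurable_box.
  exact: measurable_cube.
by rewrite lebesgue_cube ltry.
Qed.

Definition decorrelated (h : nat) (u v : 'rV[R]_d -> R) :=
  cesaro_mean (fun n => u (x (n + h)%N) * v (x n)) N @[N --> \oo]
    --> cube_mean u * cube_mean v.

Lemma decorrelated_indic h (I J : 'I_d -> interval R) :
  uniformly_distributed (fun n => row_mx (x n) (x (n + h)%N)) ->
  box I `<=` cube -> box J `<=` cube ->
  decorrelated h \1_(box I) \1_(box J).
Proof.
move=> xud Ic Jc; have := xud _ (pair_itv_cube Jc Ic).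
rewrite pair_box_frequency lebesgue_box_row_mx pair_itvl pair_itvr.
by rewrite fineM ?fin_num_lebesgue_box// mulrC -!cube_mean_indic.
Qed.

Lemma decorrelated_grid_approx h k u v :
  uniformly_distributed (fun n => row_mx (x n) (x (n + h)%N)) ->
  decorrelated h (grid_approx k u) (grid_approx k v).
Proof.
move=> xud; rewrite /decorrelated !cube_mean_grid_approx mulr_suml.
pose c (i j : {ffun 'I_d -> 'I_k.+2}) N : R :=
  cesaro_mean (fun n => \1_(box (grid_cell k (fun l => i l))) (x (n + h)%N) *
                        \1_(box (grid_cell k (fun l => j l))) (x n)) N.
have -> : cesaro_mean
      (fun n => grid_approx k u (x (n + h)%N) * grid_approx k v (x n)) =
    (fun N => \sum_(i : {ffun 'I_d -> 'I_k.+2})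
      \sum_(j : {ffun 'I_d -> 'I_k.+2})
        u (grid_point k (fun l => i l)) * v (grid_point k (fun l => j l)) *
          c i j N).
  apply/funext => N; under [RHS]eq_bigr => i _.
    under eq_bigr do rewrite -cesaro_meanZ.
    rewrite -cesaro_mean_sum; over.
  rewrite -cesaro_mean_sum; congr cesaro_mean; apply/funext => n.
  rewrite /grid_approx mulr_suml; apply: eq_bigr => i _.
  by rewrite mulr_sumr; apply: eq_bigr => j _; ring.
apply: cvg_sumr => i _; rewrite mulr_sumr; apply: cvg_sumr => j _.
rewrite mulrACA; apply: cvgM; first exact: cvg_cst.
rewrite -!cube_mean_indic; try exact: grid_cell_cube.
by apply: decorrelated_indic => //; exact: grid_cell_cube.
Qed.

Lemma decorrelated_continuous h u v :
  uniformly_distributed (fun n => row_mx (x n) (x (n + h)%N)) ->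
  {within cube, continuous u} -> {within cube, continuous v} ->
  decorrelated h u v.
Proof.
move=> xud uC vC.
have [M [M0 uM vM]] : exists M, [/\ 0 < M, forall y, cube y -> `|u y| <= M &
    forall y, cube y -> `|v y| <= M].
  have [Mu uMu] := continuous_cube_bounded uC.
  have [Mv vMv] := continuous_cube_bounded vC.
  exists (1 + `|Mu| + `|Mv|); split => [|y cy|y cy]; first by rewrite -addrA ltr_pwDl.
  - by have := uMu _ cy; have := ler_norm Mu; have := normr_ge0 Mv; lra.
  - by have := vMv _ cy; have := ler_norm Mv; have := normr_ge0 Mu; lra.
apply: cvg_of_approx => e e0.
(* Two replacements are made, [u] by [s] and [v] by [t], each costing [M * r];
   they occur once in the averages and once in the product of the means. *)
have r0 : 0 < e / (4 * M) by rewrite divr_gt0// mulr_gt0.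
set r := _ / _ in r0.
have re : 2 * M * r = e / 2 by rewrite /r; field; rewrite gt_eqF.
have [k [uk vk]] : exists k,
    (forall y, cube y -> `|u y - grid_approx k u y| <= r) /\
    (forall y, cube y -> `|v y - grid_approx k v y| <= r).
  near \oo => k; exists k; split; near: k; exact: cvg_grid_approx.
pose s := grid_approx k u; pose t := grid_approx k v.
have sM y : cube y -> `|s y| <= M.
  by move=> /(grid_approxE k u)[z [/uM cz _]]; rewrite /s => ->.
have close n : `|u (x (n + h)%N) * v (x n) - s (x (n + h)%N) * t (x n)| <= e / 2.
  by rewrite -re; apply: prod_dist; [exact: uk|exact: vk|exact: vM|exact: sM].
have : `|cube_mean u * cube_mean v - cube_mean s * cube_mean t| <= e / 2.
  rewrite -re; apply: prod_dist.
  - apply: cube_mean_dist => //; first exact: continuous_cube_integrable.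
    exact: grid_approx_integrable.
  - apply: cube_mean_dist => //; first exact: continuous_cube_integrable.
    exact: grid_approx_integrable.
  - by apply: cube_mean_bound => //; exact: continuous_cube_integrable.
  - by apply: cube_mean_bound => //; exact: grid_approx_integrable.
rewrite ler_norml => /andP[st1 st2].
have st_cvg := @decorrelated_grid_approx h k u v xud.
pose c N := cesaro_mean (fun n => s (x (n + h)%N) * t (x n)) N.
exists (fun N => c N - cesaro_mean (fun=> e / 2) N).
exists (fun N => c N + cesaro_mean (fun=> e / 2) N).
exists (cube_mean s * cube_mean t - e / 2), (cube_mean s * cube_mean t + e / 2).
split; last by split; lra.
- by apply: cvgB => //; exact: cvg_cesaro_mean_cst.
- by apply: cvgD => //; exact: cvg_cesaro_mean_cst.
- move=> N; rewrite -cesaro_meanB -cesaro_meanD.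
  apply/andP; split; apply: le_cesaro_mean => n;
    have := close n; rewrite ler_norml; lra.
Unshelve. all: by end_near. Qed.

End decorrelation.

(** * Correlations of complex sequences *)

Section complex_limits.
Context {R : realType}.
Implicit Types (z l : R[i]).

Lemma le_normc_ReIm z : `|z| <= (`|complex.Re z| + `|complex.Im z|)%:C%C.
Proof.
rewrite normc_def lecR -[leRHS]ger0_norm ?addr_ge0// -sqrtr_sqr.
rewrite ler_wsqrtr// sqrrD !real_normK ?num_real//.
by rewrite lerD2r lerDl mulrn_wge0// mulr_ge0.
Qed.

Lemma normc_ge_Im z : `|complex.Im z|%:C%C <= `|z|.
Proof.
by rewrite normc_def lecR -sqrtr_sqr ler_wsqrtr// lerDr sqr_ge0.
Qed.

Lemma cvg_complexP (T : Type) (F : set_system T) (FF : Filter F) 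
    (f : T -> R[i]) l :
  f t @[t --> F] --> l <->
  complex.Re (f t) @[t --> F] --> complex.Re l /\
  complex.Im (f t) @[t --> F] --> complex.Im l.
Proof.
have ReB (w z : R[i]) : complex.Re (w - z) = complex.Re w - complex.Re z.
  by case: w z => [? ?] [? ?].
have ImB (w z : R[i]) : complex.Im (w - z) = complex.Im w - complex.Im z.
  by case: w z => [? ?] [? ?].
split=> [/cvgrPdist_lt fl|[/cvgrPdist_lt ref /cvgrPdist_lt imf]].
  split; apply/cvgrPdist_lt => e e0.
    have : 0 < e%:C%C by rewrite ltcR.
    move=> /fl; apply: filterS => t /(le_lt_trans (normc_ge_Re _)).
    by rewrite ltcR ReB.
  have : 0 < e%:C%C by rewrite ltcR.
  move=> /fl; apply: filterS => t /(le_lt_trans (normc_ge_Im _)).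
  by rewrite ltcR ImB.
apply/cvgrPdist_lt => e e0; have eE := RRe_real (gtr0_real e0).
move: e0; rewrite -{}eE ltcR; set r := complex.Re e => r0.
have r2 : 0 < r / 2 by rewrite divr_gt0.
near=> t; rewrite (le_lt_trans (le_normc_ReIm _))// ltcR ReB ImB [ltRHS]splitr.
by rewrite ltrD//; near: t; [exact: ref|exact: imf].
Unshelve. all: by end_near. Qed.

Lemma within_continuous_complexP (T : topologicalType) (A : set T)
    (f : T -> R[i]) :
  {within A, continuous f} <->
  {within A, continuous (fun t => complex.Re (f t))} /\
  {within A, continuous (fun t => complex.Im (f t))}.
Proof.
split=> [/subspace_continuousP fC|[/subspace_continuousP ref
                                   /subspace_continuousP imf]].
  by split; apply/subspace_continuousP => t /fC /cvg_complexP[].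
apply/subspace_continuousP => t At; apply/cvg_complexP.
by split; [exact: ref|exact: imf].
Qed.

Lemma correlationE (u v : nat -> R) (N h : nat) :
  correlation (fun n => (u n +i* v n)%C) N h =
  (cesaro_mean (fun n => u (n + h)%N * u n + v (n + h)%N * v n)%R N +i*
   cesaro_mean (fun n => v (n + h)%N * u n - u (n + h)%N * v n)%R N)%C.
Proof.
have sumE (a b : nat -> R) m :
    \sum_(n < m) (a n +i* b n)%C = ((\sum_(n < m) a n) +i* \sum_(n < m) b n)%C.
  elim: m => [|m IH]; first by rewrite !big_ord0.
  by rewrite !big_ord_recr/= IH.
rewrite /correlation /cesaro_mean.
have -> : (N%:R^-1 : R[i]) = (N%:R^-1)%:C%C by rewrite fmorphV rmorph_nat.
under eq_bigr => n _.
  rewrite [_ * _](_ : _ = ((u (n + h)%N * u n + v (n + h)%N * v n) +i*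
    (v (n + h)%N * u n - u (n + h)%N * v n))%C); first over.
  by simpc; congr (_ +i* _)%C; ring.
rewrite (sumE (fun n => u (n + h)%N * u n + v (n + h)%N * v n)
  (fun n => v (n + h)%N * u n - u (n + h)%N * v n)).
by simpc.
Qed.

End complex_limits.

(** * Near orthogonality along all indices *)

Section diagonal_extraction.
Context {R : realType}.
Import ArrowAsProduct.

(** The sequence of columns [fun h => g h N], with [N] in [A], lives in a product
    of segments, which is compact; it has a cluster point [c].  Indices are
    chosen successively so that at step [q] the first [q] coordinates are within
    [1 / (q + 1)] of those of [c]. *)
Lemma diagonal_extraction (g : nat -> nat -> R) (M : R) (A : set nat) :
  (forall h N, `|g h N| <= M) -> (forall n, exists2 N, (n < N)%N & A N) ->
  exists Nq : nat -> nat, [/\ {homo Nq : p q / (p < q)%N},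
    forall q, (0 < Nq q)%N, forall q, A (Nq q) &
    forall h, cvg (g h (Nq q) @[q --> \oo])].
Proof.
move=> gM Ainf.
pose G N : forall h : nat, R := fun h => g h N.
have cptM := @tychonoff nat (fun=> R) (fun=> `[- M, M]%classic)
  (fun=> @segment_compact R (- M) M).
pose F := G @ within A \oo.
have FF : ProperFilter F.
  apply: fmap_proper_filter; apply: Build_ProperFilter_ex => P [n _ nP].
  have [N nN AN] := Ainf n; exists N; apply: nP => //=; exact: ltnW.
have FM : F [set f | forall h, `[- M, M]%classic (f h)].
  apply: nearW => N _ h /=; rewrite in_itv/= -ler_norml; exact: gM.
have [c [_ Fc]] := cptM F FF FM.
have step (p : nat * nat) : exists N, [/\ (p.2 < N)%N, A N &
    forall h, (h < p.1)%N -> `|c h - g h N| < p.1.+1%:R^-1].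
  case: p => q m /=.
  have F1 : F [set G N | N in [set N | (m < N)%N /\ A N]].
    by exists m.+1 => // N /= mN AN; exists N.
  have nbhsc : nbhs c [set f | forall h, (h < q)%N -> `|c h - f h| < q.+1%:R^-1].
    have H h : nbhs c [set f | `|c h - f h| < q.+1%:R^-1].
      have /cvgrPdist_lt := @proj_continuous nat (fun=> R) h c.
      by apply; rewrite invr_gt0.
    have : nbhs c [set f : nat -> R | forall h : 'I_q, `|c h - f h| < q.+1%:R^-1].
      exact: (@filter_forall _ 'I_q
        (fun h => [set f : nat -> R | `|c h - f h| < q.+1%:R^-1]) (nbhs c)
        (nbhs_filter c) (fun h => H h)).
    by apply: filterS => f Hf h hq; exact: (Hf (Ordinal hq)).
  have [_ [[N [mN AN] <-] GN]] := Fc _ _ F1 nbhsc.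
  by exists N; split.
have [sel selP] := choice step.
pose fix Nq q := if q is p.+1 then sel (p.+1, Nq p) else sel (0, 0)%N.
have Nq_step q : (Nq q < Nq q.+1)%N by have [] := selP (q.+1, Nq q).
have Nq_c q : A (Nq q) /\ forall h, (h < q)%N -> `|c h - g h (Nq q)| < q.+1%:R^-1.
  case: q => [|q]; first by have [] := selP (0, 0)%N.
  by have [] := selP (q.+1, Nq q).
have Nq_homo : {homo Nq : p q / (p < q)%N}.
  by apply: homo_ltn => //; exact: ltn_trans.
exists Nq; split => //.
- case=> [|q]; first by have [] := selP (0, 0)%N.
  exact: leq_trans (Nq_step q).
- by move=> q; have [] := Nq_c q.
- move=> h; apply/cvg_ex; exists (c h); apply/cvgrPdist_lt => e e0.
  near=> q; have [_ /(_ h) cq] := Nq_c q.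
  apply: (lt_trans (cq _)); first by near: q; exact: nbhs_infty_gt.
  by near: q; exact: near_infty_natSinv_lt (PosNum e0).
Unshelve. all: by end_near. Qed.

End diagonal_extraction.

Lemma cvg_correlation0P (R : realType) (u v : nat -> R) (h : nat) :
  correlation (fun n => (u n +i* v n)%C) N h @[N --> \oo] --> (0 : R[i]) <->
  cesaro_mean (fun n => u (n + h)%N * u n + v (n + h)%N * v n) N
    @[N --> \oo] --> (0 : R) /\
  cesaro_mean (fun n => v (n + h)%N * u n - u (n + h)%N * v n) N
    @[N --> \oo] --> (0 : R).
Proof.
have E : (fun N => correlation (fun n => (u n +i* v n)%C) N h) =
    (fun N => cesaro_mean (fun n => u (n + h)%N * u n + v (n + h)%N * v n) N +i*
    cesaro_mean (fun n => v (n + h)%N * u n - u (n + h)%N * v n) N)%C.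
  by apply/funext => N; exact: correlationE.
by rewrite E; split=> [/cvg_complexP|?]//; exact/cvg_complexP.
Qed.

Section nearly_orthogonal.
Context {R : realType}.
Implicit Types (z : nat -> R[i]).

Lemma correlation_bounded z (M : R) N h : (forall n, `|z n| <= M%:C%C) ->
  `|correlation z N h| <= (M ^+ 2)%:C%C.
Proof.
move=> zM; have M0 : 0 <= M%:C%C by apply: le_trans (zM 0%N).
rewrite /correlation normrM normfV normr_nat.
have [->|N0] := posnP N; first by rewrite invr0 mulr0 lecR sqr_ge0.
rewrite ler_pdivrMr ?ltr0n// (le_trans (ler_norm_sum _ _ _))//.
have -> : (M ^+ 2)%:C%C * N%:R = \sum_(n < N) (M ^+ 2)%:C%C :> R[i].
  by rewrite sumr_const card_ord mulr_natr.
apply: ler_sum => n _; rewrite normrM norm_conjC rmorphXn expr2.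
by rewrite ler_pM.
Qed.

(** Otherwise a correlation would stay away from [0] along an infinite set of
    indices; a permissible subsequence of that set contradicts near
    orthogonality. *)
Lemma nearly_orthogonal_correlation z h : nearly_orthogonal z -> (0 < h)%N ->
  correlation z N h @[N --> \oo] --> (0 : R[i]).
Proof.
move=> [[M zM] zO] h0; apply: contrapT => ncvg.
have [e e0 eA] : exists2 e : R[i], 0 < e & forall n, exists2 N, (n < N)%N &
    ~ (`|correlation z N h| < e).
  apply: contrapT => noe; apply: ncvg; apply/cvgr0Pnorm_lt => e e0.
  apply: contrapT => nne; apply: noe; exists e => // n.
  apply: contrapT => nN; apply: nne; exists n.+1 => // N /= nltN.
  by apply: contrapT => Ne; apply: nN; exists N.
(* Real parts at even places and imaginary parts at odd places: one real family
   whose convergence at every place makes all complex correlations converge. *)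
pose g k N : R := if odd k then complex.Im (correlation z N k./2)
                  else complex.Re (correlation z N k./2).
have gM k N : `|g k N| <= M ^+ 2.
  rewrite -lecR (le_trans _ (correlation_bounded N k./2 zM))// /g.
  by case: ifP => _; [exact: normc_ge_Im|exact: normc_ge_Re].
have [Nq [Nq_homo Nq0 NqA Nq_cvg]] := diagonal_extraction gM eA.
have perm : permissible z Nq.
  split => //; first by exists M.
  move=> k _.
  have /cvg_ex[a ga] := Nq_cvg k.*2; have /cvg_ex[b gb] := Nq_cvg k.*2.+1.
  apply/cvg_ex; exists (a +i* b)%C; apply/cvg_complexP; split.
    by move: ga; rewrite /g odd_double doubleK.
  by move: gb; rewrite /g /= odd_double/= uphalf_double.
have /cvgr0Pnorm_lt /(_ _ e0) [n _ /(_ n (leqnn n))] := zO _ perm _ h0.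
by rewrite /= normr_id; exact: NqA.
Qed.

End nearly_orthogonal.

(** * O-sequences and decorrelation *)

Section o_sequences.
Context {R : realType} {d : nat}.
Variables (x : nat -> 'rV[R]_d).
Hypothesis x_cube : forall n, unit_cube R d (x n).
Notation cube := (unit_cube R d).
Implicit Types u v : 'rV[R]_d -> R.

Lemma decorrelated_o_sequence :
  (forall h u v, (0 < h)%N -> {within cube, continuous u} ->
     {within cube, continuous v} -> decorrelated x h u v) ->
  o_sequence x.
Proof.
move=> xP f /within_continuous_complexP[]; set u := fun y => complex.Re (f y).
set v := fun y => complex.Im (f y) => uC vC [u0 v0].
have fE : f \o x = (fun n => (u (x n) +i* v (x n))%C).
  by apply/funext => n /=; rewrite /u /v; case: (f (x n)).
split.
  have [Mu uM] := continuous_cube_bounded uC.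
  have [Mv vM] := continuous_cube_bounded vC.
  exists (Mu + Mv) => n; rewrite (le_trans (le_normc_ReIm _))// lecR.
  by rewrite lerD//; [exact: uM|exact: vM].
move=> Nq [_ _ Nq_homo _] h h0.
have corr0 : correlation (f \o x) N h @[N --> \oo] --> (0 : R[i]).
  have dec (a b : _ -> R) :
      {within cube, continuous a} -> {within cube, continuous b} ->
      cube_mean b = 0 ->
      cesaro_mean (fun n => a (x (n + h)%N) * b (x n)) N @[N --> \oo] --> (0 : R).
    by move=> aC bC b0; have := xP h a b h0 aC bC; rewrite /decorrelated b0 mulr0.
  rewrite fE; apply/(cvg_correlation0P (u \o x) (v \o x)); split.
    rewrite (_ : cesaro_mean _ = (fun N =>
        cesaro_mean (fun n => u (x (n + h)%N) * u (x n)) N +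
        cesaro_mean (fun n => v (x (n + h)%N) * v (x n)) N)); last first.
      by apply/funext => N; rewrite -cesaro_meanD.
    by rewrite -[0]addr0; apply: cvgD; exact: dec.
  rewrite (_ : cesaro_mean _ = (fun N =>
      cesaro_mean (fun n => v (x (n + h)%N) * u (x n)) N -
      cesaro_mean (fun n => u (x (n + h)%N) * v (x n)) N)); last first.
    by apply/funext => N; rewrite -cesaro_meanB.
  by rewrite -[0]subr0; apply: cvgB; exact: dec.
have NqE : Nq q @[q --> \oo] --> \oo.
  have Nq_ge q : (q <= Nq q)%N.
    by elim: q => // q IH; exact: leq_ltn_trans IH (Nq_homo _ _ (ltnSn q)).
  move=> P [n _ nP]; exists n => // q /= nq; apply: nP => /=.
  exact: leq_trans nq _.
apply/cvgr0Pnorm_lt => e e0.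
have /cvgr0Pnorm_lt /(_ _ e0) := cvg_comp _ _ NqE corr0.
by apply: filterS => q; rewrite normr_id.
Qed.

(** Polarization.  Let [B a b] be the limit average of [a (x (n + h)) * b (x n)].
    An o-sequence makes the correlation of [a + i b] vanish, whose real part is
    [B a a + B b b] and whose imaginary part is [B b a - B a b].  Then
    [2 * B u v = B w w - B u u - B v v - (B v u - B u v)] with [w = u + v]. *)
Lemma o_sequence_decorrelated0 h u v : o_sequence x -> (0 < h)%N ->
  {within cube, continuous u} -> {within cube, continuous v} ->
  cube_mean u = 0 -> cube_mean v = 0 ->
  cesaro_mean (fun n => u (x (n + h)%N) * v (x n)) N @[N --> \oo] --> (0 : R).
Proof.
move=> xo h0 uC vC u0 v0.
have corr0 (a b : _ -> R) :
    {within cube, continuous a} -> {within cube, continuous b} ->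
    cube_mean a = 0 -> cube_mean b = 0 ->
    cesaro_mean (fun n => a (x (n + h)%N) * a (x n) + b (x (n + h)%N) * b (x n)) N
      @[N --> \oo] --> (0 : R) /\
    cesaro_mean (fun n => b (x (n + h)%N) * a (x n) - a (x (n + h)%N) * b (x n)) N
      @[N --> \oo] --> (0 : R).
  move=> aC bC a0 b0; pose f y := (a y +i* b y)%C.
  have fC : {within cube, continuous f} by apply/within_continuous_complexP.
  have f0 : cube_integral f = 0.
    suff : (cube_mean a +i* cube_mean b)%C = 0 by [].
    by rewrite a0 b0.
  apply/(cvg_correlation0P (a \o x) (b \o x)).
  exact: nearly_orthogonal_correlation (xo f fC f0) h0.
have self (a : _ -> R) : {within cube, continuous a} -> cube_mean a = 0 ->
    cesaro_mean (fun n => a (x (n + h)%N) * a (x n)) N @[N --> \oo] --> (0 : R).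
  move=> aC a0; have [] := corr0 a (fun=> 0) aC _ a0 (cube_mean_cst 0).
    by apply: continuous_subspaceT; exact: cst_continuous.
  by under [X in cesaro_mean X]eq_fun do rewrite mulr0 addr0.
pose w y := u y + v y.
have wC : {within cube, continuous w} by exact: within_continuousD.
have w0 : cube_mean w = 0.
  rewrite /cube_mean RintegralD ?[X in X + _]u0 ?[X in _ + X]v0 ?addr0//.
  - exact: measurable_cube.
  - exact: continuous_cube_integrable.
  - exact: continuous_cube_integrable.
have [_ anti] := corr0 u v uC vC u0 v0.
have -> : cesaro_mean (fun n => u (x (n + h)%N) * v (x n)) = (fun N => 2^-1 *
    (cesaro_mean (fun n => w (x (n + h)%N) * w (x n)) N -
     cesaro_mean (fun n => u (x (n + h)%N) * u (x n)) N -
     cesaro_mean (fun n => v (x (n + h)%N) * v (x n)) N -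
     cesaro_mean
       (fun n => v (x (n + h)%N) * u (x n) - u (x (n + h)%N) * v (x n)) N)).
  apply/funext => N; rewrite -!cesaro_meanB -cesaro_meanZ.
  by congr cesaro_mean; apply/funext => n; rewrite /w; field.
have := cvgM (cvg_cst (2^-1 : R))
  (cvgB (cvgB (cvgB (self w wC w0) (self u uC u0)) (self v vC v0)) anti).
by rewrite !subr0 mulr0; exact.
Qed.

(** The case of mean zero gives, through van der Corput's theorem, the averages
    of a single function; expanding the product of the centred functions then
    settles the general case. *)
Lemma o_sequence_decorrelated h u v : o_sequence x -> (0 < h)%N ->
  {within cube, continuous u} -> {within cube, continuous v} ->
  decorrelated x h u v.
Proof.
move=> xo h0 uC vC.
have centered (a : _ -> R) : {within cube, continuous a} ->
    {within cube, continuous (fun y => a y - cube_mean a)} /\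
    cube_mean (fun y => a y - cube_mean a) = 0.
  move=> aC; have cC : {within cube, continuous (fun=> cube_mean a)}.
    by apply: continuous_subspaceT; exact: cst_continuous.
  split; first by apply: within_continuousB.
  rewrite {1}/cube_mean RintegralB//.
  - by rewrite [X in _ - X]cube_mean_cst subrr.
  - exact: measurable_cube.
  - exact: continuous_cube_integrable.
  - exact: continuous_cube_integrable.
have mean (a : _ -> R) : {within cube, continuous a} ->
    cesaro_mean (fun n => a (x n)) N @[N --> \oo] --> cube_mean a.
  move=> aC; have [bC b0] := centered a aC.
  set b := fun y => _ in bC b0; have [M bM] := continuous_cube_bounded bC.
  have bmean : cesaro_mean (fun n => b (x n)) N @[N --> \oo] --> (0 : R).
    apply: (@van_der_corput _ _ M) => [n|k k0]; first exact: bM.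
    exact: o_sequence_decorrelated0.
  have -> : cesaro_mean (fun n => a (x n)) = (fun N =>
      cesaro_mean (fun n => b (x n)) N + cesaro_mean (fun=> cube_mean a) N).
    apply/funext => N; rewrite -cesaro_meanD.
    by congr cesaro_mean; apply/funext => n; rewrite /b subrK.
  by rewrite -[X in _ --> X]add0r; apply: cvgD => //; exact: cvg_cesaro_mean_cst.
have [M uM] := continuous_cube_bounded uC.
have umean : cesaro_mean (fun n => u (x (n + h)%N)) N @[N --> \oo] --> cube_mean u.
  apply: (@cvg_cesaro_mean_shift _ (fun n => u (x n)) M) => [n|]; first exact: uM.
  exact: mean.
have [u1C u10] := centered u uC; have [v1C v10] := centered v vC.
have dec := o_sequence_decorrelated0 xo h0 u1C v1C u10 v10.
rewrite /decorrelated.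
have -> : cesaro_mean (fun n => u (x (n + h)%N) * v (x n)) = (fun N =>
    cesaro_mean
      (fun n => (u (x (n + h)%N) - cube_mean u) * (v (x n) - cube_mean v)) N
    + (cube_mean u * cesaro_mean (fun n => v (x n)) N +
       cube_mean v * cesaro_mean (fun n => u (x (n + h)%N)) N -
       cesaro_mean (fun=> cube_mean u * cube_mean v) N)).
  apply/funext => N.
  rewrite -!cesaro_meanZ -cesaro_meanD -cesaro_meanB -cesaro_meanD.
  by congr cesaro_mean; apply/funext => n; ring.
have := cvgD dec (cvgB (cvgD (cvgM (cvg_cst (cube_mean u)) (mean v vC))
  (cvgM (cvg_cst (cube_mean v)) umean))
  (@cvg_cesaro_mean_cst R (cube_mean u * cube_mean v))).
by rewrite add0r (mulrC (cube_mean v)) addrK; exact.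
Qed.

End o_sequences.

(** * From decorrelation to uniformly distributed pairs *)

Section trapezoid.
Context {R : realType}.
Implicit Types (a b e s : R).

(** The trapezoid with feet [a] and [b], slopes [1 / e] and height [1], cut to a
    triangle if [b - a < 2 * e]. *)
Definition trapezoid a b e s : R :=
  Num.min 1 (Num.max 0 (Num.min (s - a) (b - s) / e)).

Lemma trapezoid_ge0 a b e s : 0 <= trapezoid a b e s.
Proof. by rewrite /trapezoid le_min ler01/= le_max lexx. Qed.

Lemma trapezoid_le1 a b e s : trapezoid a b e s <= 1.
Proof. by rewrite /trapezoid ge_min lexx. Qed.

Lemma trapezoid_eq1 a b e s : 0 < e -> a + e <= s <= b - e ->
  trapezoid a b e s = 1.
Proof.
move=> e0 /andP[as_ sb]; apply/min_idPl; rewrite le_max; apply/orP; right.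
by rewrite ler_pdivlMr// mul1r le_min; apply/andP; split; lra.
Qed.

Lemma trapezoid_eq0 a b e s : 0 < e -> ~ (a < s < b) -> trapezoid a b e s = 0.
Proof.
move=> e0 /negP; rewrite negb_and -!leNgt => sab.
have t0 : Num.min (s - a) (b - s) / e <= 0.
  rewrite pmulr_lle0 ?invr_gt0// ge_min !subr_le0.
  by case/orP: sab => ->; rewrite ?orbT.
by rewrite /trapezoid (max_idPl t0) (min_idPr ler01).
Qed.

Lemma continuous_trapezoid a b e : continuous (trapezoid a b e).
Proof.
apply: min_fun_continuous; first exact: cst_continuous.
apply: max_fun_continuous; first exact: cst_continuous.
move=> s; apply: cvgM; last exact: cvg_cst.
apply: (@min_fun_continuous _ _ _ (fun s => s - a) (fun s => b - s)) => t.
  by apply: cvgB; [exact: cvg_id|exact: cvg_cst].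
by apply: cvgB; [exact: cvg_cst|exact: cvg_id].
Qed.

End trapezoid.

Lemma le_indic (R : realType) (T : Type) (A B : set T) (t : T) :
  A `<=` B -> \1_A t <= \1_B t :> R.
Proof.
move=> AB; rewrite !indicE ler_nat; have [/set_mem At|//] := boolP (t \in A).
by rewrite mem_set//; exact: AB.
Qed.

Section box_sandwich.
Context {R : realType} {d : nat}.
Notation cube := (unit_cube R d).
Notation mu := (lebesgue_rV R d).
Implicit Types (a b : 'I_d -> R) (J : 'I_d -> interval R).

Definition box_trapezoid a b (e : R) (y : 'rV[R]_d) : R :=
  \prod_i trapezoid (a i) (b i) e (y ord0 i).

Lemma continuous_box_trapezoid a b e : continuous (box_trapezoid a b e).
Proof.
apply: continuous_big => [|i _ y]; first exact: mul_continuous.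
apply: (@continuous_comp _ _ _ (fun y : 'rV[R]_d => y ord0 i)).
  exact: coord_continuous.
exact: continuous_trapezoid.
Qed.

Lemma box_trapezoid_ge0 a b e y : 0 <= box_trapezoid a b e y.
Proof. by apply: prodr_ge0 => i _; exact: trapezoid_ge0. Qed.

Lemma box_trapezoid_le1 a b e y : box_trapezoid a b e y <= 1.
Proof. by apply: prodr_ile1 => i _; rewrite trapezoid_ge0 trapezoid_le1. Qed.

Lemma box_trapezoid_ge_indic a b e y : 0 < e ->
  \1_(box (fun i => `[a i + e, b i - e])) y <= box_trapezoid a b e y.
Proof.
move=> e0; rewrite indicE; have [/set_mem yab|_] := boolP (_ \in _); last first.
  exact: box_trapezoid_ge0.
rewrite /box_trapezoid big1// => i _; apply: trapezoid_eq1 => //.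
by have := yab i; rewrite in_itv.
Qed.

Lemma box_trapezoid_le_indic a b e y : 0 < e ->
  box_trapezoid a b e y <= \1_(box (fun i => `]a i, b i[)) y.
Proof.
move=> e0; rewrite indicE; have [_|/negP yab] := boolP (_ \in _).
  exact: box_trapezoid_le1.
have [i yi] : exists i, ~ (a i < y ord0 i < b i).
  apply: contrapT => nex; apply: yab; apply/mem_set => i; rewrite in_itv/=.
  by apply: contrapT => yi; apply: nex; exists i.
by rewrite /box_trapezoid (bigD1 i)//= trapezoid_eq0// mul0r.
Qed.

(** The volume of a box does not depend on which of its faces it contains; an
    empty side is accounted for by the maximum with [0]. *)
Lemma lebesgue_box_sides (c c' : bool) a b :
  mu (box (fun i => Interval (BSide c (a i)) (BSide c' (b i)))) =
  (\prod_i Num.max 0 (b i - a i))%:E.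
Proof.
rewrite lebesgue_box (big_morph EFin (@EFinM R) erefl).
apply: eq_bigr => i _; rewrite lebesgue_measure_itv/= lte_fin.
by case: ltP => ab; [rewrite -EFinB|]; congr EFin; apply/esym;
  [apply/max_idPr|apply/max_idPl]; lra.
Qed.

(** The point [p] keeps the interval from being empty, and the bounds keep it
    from being infinite: otherwise it would contain [p - 2] or [p + 2]. *)
Lemma itv_ends (I : interval R) (p : R) : p \in I ->
  (forall s, s \in I -> 0 <= s <= 1) ->
  exists ab : R * R, (forall s, ab.1 < s < ab.2 -> s \in I) /\
                     (forall s, s \in I -> ab.1 <= s <= ab.2).
Proof.
move=> pI I01; have p01 := I01 _ pI.
have pm : p - 2 \notin I by apply/negP => /I01; lra.
have pp : p + 2 \notin I by apply/negP => /I01; lra.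
case: I pI {I01} pm pp => [[bl a|[|]] [br b|[|]]]; rewrite !in_itv/= ?andbF//.
- move=> pI _ _; exists (a, b); split=> s /=; rewrite in_itv/=;
    by case: bl br pI => -[]/= pI; lra.
- by case: bl => /=; lra.
- by case: br => /=; lra.
Qed.

(** [a] and [b] collect the end points of the sides of [J], whichever of these
    end points belong to [J]. *)
Definition box_between a b J := forall i (s : R),
  (a i < s < b i -> s \in J i) /\ (s \in J i -> a i <= s <= b i).

(** Nonemptiness is what makes the sides of the box subsets of [[0, 1]]: one
    coordinate of a point of the box can then be moved freely along its side. *)
Lemma box_ends J : box J `<=` cube -> box J !=set0 ->
  exists a b, box_between a b J.
Proof.
move=> Jc [y yJ].
have /choice[ab abP] i : exists ab : R * R, forall s,
    (ab.1 < s < ab.2 -> s \in J i) /\ (s \in J i -> ab.1 <= s <= ab.2).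
  have [||ab [ab1 ab2]] := @itv_ends (J i) (y ord0 i); first exact: yJ.
    move=> s sJ; have : box J (\row_j (if j == i then s else y ord0 j)).
      by move=> j; rewrite mxE; case: eqP => [->|_]; [|exact: yJ].
    by move=> /Jc /(_ i); rewrite mxE eqxx in_itv.
  by exists ab => s; split; [exact: ab1|exact: ab2].
by exists (fun i => (ab i).1), (fun i => (ab i).2) => i s; exact: abP.
Qed.

(** The trapezoids with ends [a], [b] lie below the indicator, and those with
    ends [a - r], [b + r] above it.  Their means differ by at most the
    difference of the volumes of two boxes whose sides have lengths
    [b - a + 2 * r] and [b - a - 2 * r], which tends to [0] with [r] since the
    volume is continuous in the side lengths. *)
Lemma box_sandwich J e : box J `<=` cube -> box J !=set0 -> 0 < e ->
  exists L U : 'rV[R]_d -> R, [/\ continuous L, continuous U,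
    forall y, [/\ 0 <= L y, L y <= \1_(box J) y, \1_(box J) y <= U y & U y <= 1],
    `|cube_mean L - cube_mean \1_(box J)| <= e &
    `|cube_mean U - cube_mean \1_(box J)| <= e].
Proof.
move=> Jc J0 e0; have [a [b abJ]] := box_ends Jc J0.
(* [V t] is the volume of the box with all sides of [J] lengthened by [t]. *)
pose V r := \prod_i Num.max 0 (b i - a i + r).
have V_cont : continuous V.
  apply: continuous_big => [|i _]; first exact: mul_continuous.
  apply: max_fun_continuous; first exact: cst_continuous.
  by move=> r; apply: cvgD; [exact: cvg_cst|exact: cvg_id].
have [r r0 Vr] : exists2 r, 0 < r & V (2 * r) - V (- (2 * r)) <= e.
  have e2 : 0 < e / 2 by rewrite divr_gt0.
  have /cvgrPdist_le /(_ _ e2) /nbhs_ballP[r /= r0 rV] := V_cont 0.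
  have r4 : 0 < r / 4 by rewrite divr_gt0.
  exists (r / 4) => //.
  have : `|V 0 - V (2 * (r / 4))| <= e / 2.
    by apply: rV; rewrite /ball/= sub0r normrN gtr0_norm; lra.
  have : `|V 0 - V (- (2 * (r / 4)))| <= e / 2.
    by apply: rV; rewrite /ball/= sub0r opprK gtr0_norm; lra.
  by rewrite !ler_norml; lra.
pose a' i := a i - r; pose b' i := b i + r.
exists (box_trapezoid a b r), (box_trapezoid a' b' r).
have cont f : continuous f -> mu.-integrable cube (EFin \o f).
  by move=> fC; apply: continuous_cube_integrable; exact: continuous_subspaceT.
have int_trap a1 b1 : mu.-integrable cube (EFin \o box_trapezoid a1 b1 r).
  by apply: cont; exact: continuous_box_trapezoid.
have LJ y : box_trapezoid a b r y <= \1_(box J) y.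
  apply: (le_trans (box_trapezoid_le_indic _ _ _ r0)).
  apply: le_indic => z zab i; have [+ _] := abJ i (z ord0 i); apply.
  by have := zab i; rewrite in_itv.
have JU y : \1_(box J) y <= box_trapezoid a' b' r y.
  apply: le_trans (box_trapezoid_ge_indic _ _ _ r0).
  apply: le_indic => z zJ i; have [_ /(_ (zJ i))] := abJ i (z ord0 i).
  by rewrite in_itv/= /a' /b'; lra.
have gap : cube_mean (box_trapezoid a' b' r) -
    cube_mean (box_trapezoid a b r) <= e.
  apply: le_trans Vr; apply: lerB.
  - apply: (@le_trans _ _ (cube_mean \1_(box (fun i => `]a' i, b' i[)))).
      apply: le_cube_mean; [|exact: indic_box_integrable|].
        exact: int_trap.
      by move=> y _; exact: box_trapezoid_le_indic.
    have le_mu : (mu (box (fun i => `]a' i, b' i[) `&` cube) <= (V (2 * r))%:E)%E.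
      rewrite (_ : V _ = \prod_i Num.max 0 (b' i - a' i)); last first.
        by apply: eq_bigr => i _; congr Num.max; rewrite /a' /b'; ring.
      rewrite -(lebesgue_box_sides false true).
      apply: le_measure; rewrite ?inE; last exact: subIsetl.
        by apply: measurableI; [exact: measurable_box|exact: measurable_cube].
      exact: measurable_box.
    rewrite /cube_mean /Rintegral integral_indic//; last 2 first.
    - exact: measurable_cube.
    - exact: measurable_box.
    rewrite -lee_fin fineK// ge0_fin_numE//.
    exact: le_lt_trans le_mu (ltry _).
  - apply: (@le_trans _ _ (cube_mean \1_(box (fun i => `[a i + r, b i - r])))).
      rewrite cube_mean_indic.
        rewrite lebesgue_box_sides/=; apply: ler_prod => i _.
        rewrite le_max lexx/= (_ : b i - a i + _ = b i - r - (a i + r))//.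
        by ring.
      move=> y yab; apply: Jc => i; have [+ _] := abJ i (y ord0 i); apply.
      by have := yab i; rewrite in_itv/=; lra.
    apply: le_cube_mean; [exact: indic_box_integrable| |].
      by apply: cont; exact: continuous_box_trapezoid.
    by move=> y _; exact: box_trapezoid_ge_indic.
have mLJ : cube_mean (box_trapezoid a b r) <= cube_mean \1_(box J).
  by apply: le_cube_mean => //; exact: indic_box_integrable.
have mJU : cube_mean \1_(box J) <= cube_mean (box_trapezoid a' b' r).
  by apply: le_cube_mean => //; exact: indic_box_integrable.
split; try exact: continuous_box_trapezoid.
- by move=> y; split => //; [exact: box_trapezoid_ge0|exact: box_trapezoid_le1].
- by rewrite ler_norml; lra.
- by rewrite ler_norml; lra.
Qed.

End box_sandwich.

Section converse.
Context {R : realType} {d : nat}.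
Variables (x : nat -> 'rV[R]_d).
Notation cube := (unit_cube R d).

(** An empty box is treated apart, as its factors need not lie in the cube.  For
    a nonempty one the averages of the products of indicators are squeezed
    between those of the approximating continuous functions. *)
Lemma decorrelated_uniformly_distributed h :
  (forall u v, {within cube, continuous u} -> {within cube, continuous v} ->
     decorrelated x h u v) ->
  uniformly_distributed (fun n => row_mx (x n) (x (n + h)%N)).
Proof.
move=> xP K Kc; rewrite pair_box_frequency.
set J := K \o @rshift d d; set I := K \o @lshift d d.
have [K0|/set0P[z Kz]] := eqVneq (box K) set0.
  rewrite K0 measure0 (_ : (fun n => _) = (fun=> 0 : R)).
    exact: cvg_cesaro_mean_cst.
  by apply/funext => n; rewrite -indic_box_row_mx K0 indic0.
have [zI zJ] : box I (lsubmx z) /\ box J (rsubmx z).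
  by apply/box_row_mx; rewrite hsubmxK.
have Ic : box I `<=` cube.
  by move=> y yI; have /cube_row_mx[] : unit_cube R (d + d) (row_mx y (rsubmx z))
    by apply: Kc; apply/box_row_mx.
have Jc : box J `<=` cube.
  by move=> y yJ; have /cube_row_mx[] : unit_cube R (d + d) (row_mx (lsubmx z) y)
    by apply: Kc; apply/box_row_mx.
rewrite lebesgue_box_row_mx fineM ?fin_num_lebesgue_box// mulrC -!cube_mean_indic//.
apply: cvg_of_approx => e e0; have e2 : 0 < e / 2 by rewrite divr_gt0.
have [L1 [U1 [L1C U1C LU1 mL1 mU1]]] := box_sandwich Jc (ex_intro _ _ zJ) e2.
have [L2 [U2 [L2C U2C LU2 mL2 mU2]]] := box_sandwich Ic (ex_intro _ _ zI) e2.
exists (cesaro_mean (fun n => L1 (x (n + h)%N) * L2 (x n))).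
exists (cesaro_mean (fun n => U1 (x (n + h)%N) * U2 (x n))).
exists (cube_mean L1 * cube_mean L2), (cube_mean U1 * cube_mean U2).
split.
- by apply: xP; exact: continuous_subspaceT.
- by apply: xP; exact: continuous_subspaceT.
- move=> N; rewrite -/(cesaro_mean (fun n =>
    \1_(box J) (x (n + h)%N) * \1_(box I) (x n)) N).
  apply/andP; split; apply: le_cesaro_mean => n;
    have [? ? ? ?] := LU1 (x (n + h)%N); have [? ? ? ?] := LU2 (x n).
  + by apply: ler_pM.
  + by apply: ler_pM; rewrite // indicE.
- have mean1 (f : _ -> R) :
      continuous f -> (forall y, 0 <= f y <= 1) -> `|cube_mean f| <= 1.
    move=> fC f01; apply: cube_mean_bound => [|y _].
      by apply: continuous_cube_integrable; exact: continuous_subspaceT.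
    by have /andP[? ?] := f01 y; rewrite ger0_norm.
  have indic1 (Q : 'I_d -> interval R) : `|cube_mean \1_(box Q) : R| <= 1.
    apply: cube_mean_bound => [|y _]; first exact: indic_box_integrable.
    by rewrite indicE normr_nat lern1 leq_b1.
  have : `|cube_mean L1 * cube_mean L2 -
      cube_mean \1_(box J) * cube_mean \1_(box I)| <= 2 * 1 * (e / 2).
    apply: prod_dist => //; apply: mean1 => // y.
    have [L0 LI IU U1'] := LU2 y; rewrite L0/=.
    exact: le_trans LI (le_trans IU U1').
  have : `|cube_mean U1 * cube_mean U2 -
      cube_mean \1_(box J) * cube_mean \1_(box I)| <= 2 * 1 * (e / 2).
    apply: prod_dist => //; apply: mean1 => // y.
    have [L0 LI IU ->] := LU2 y; rewrite andbT.
    exact: le_trans L0 (le_trans LI IU).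
  by rewrite !ler_norml; lra.
Qed.

End converse.

Theorem theorem3p5 (R : realType) (d : nat) (x : nat -> 'rV[R]_d) :
  (0 < d)%N -> (forall n, unit_cube R d (x n)) ->
  (o_sequence x <->
   forall h : nat, (0 < h)%N ->
     uniformly_distributed (fun n => row_mx (x n) (x (n + h)%N))).
Proof.
move=> _ x_cube; split=> [xo h h0|xud].
  apply: decorrelated_uniformly_distributed => u v uC vC.
  exact: o_sequence_decorrelated.
apply: decorrelated_o_sequence => // h u v h0 uC vC.
by apply: decorrelated_continuous => //; exact: xud.
Qed.
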